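(* Let $n\ge 1$ be an integer and let $S^n$ be the $n$-sphere with its geodesic metric, so that $S^n$ has diameter $\pi$. For every real number $r$ with $\frac{2\pi}{3}<r\le\pi$, the anti-Vietoris--Rips metric thickening $\mathrm{AVR}^m(S^n;r)$ is homotopy equivalent to real projective space $\mathbb{RP}^n$.
   Context: For a metric space $(X,d)$ and a subset $A\subseteq X$, $\mathrm{spread}(A)=\inf\{d(x,x') : x\ne x',\ x,x'\in A\}$, with the convention that a singleton has spread $\infty$. For $r\ge 0$, the anti-Vietoris--Rips metric thickening $\mathrm{AVR}^m(X;r)$ is the set of all finitely supported probability measures $\sum_{i=0}^k\lambda_i\delta_{x_i}$ on $X$ (with $k\ge 0$, $\lambda_i>0$, $\sum_i\lambda_i=1$, the $x_i$ distinct) whose support satisfies $\mathrm{spread}(\{x_0,\dots,x_k\})\ge r$, i.e. $d(x_i,x_j)\ge r$ for all $i\ne j$. It is equipped with the (topology of the) $1$-Wasserstein metric $W_1(\mu,\nu)=\inf_{\pi}\int_{X\times X}d(x,y)\,d\pi$, where the infimum is over probability measures $\pi$ on $X\times X$ with marginals $\mu$ and $\nu$. The space $\mathbb{RP}^n$ is $S^n/(x\sim -x)$. *)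

(* Defs.v *)
From HB Require Import structures.
From mathcomp Require Import all_boot all_order all_algebra generic_quotient finmap.
From mathcomp Require Import ring lra.
From mathcomp Require Import all_classical all_reals all_analysis.

Set Implicit Arguments.
Unset Strict Implicit.
Unset Printing Implicit Defensive.

Import Order.TTheory GRing.Theory Num.Theory.
Import numFieldNormedType.Exports.

Local Open Scope classical_set_scope.
Local Open Scope ring_scope.

Section Homotopy.
Variable R : realType.

Definition homotopic (X Y : topologicalType) (f g : X -> Y) : Prop :=
  exists H : X * R -> Y,
    [/\ {within [set: X] `*` `[0, 1], continuous H},
        forall x, H (x, 0) = f x &
        forall x, H (x, 1) = g x].

Definition homotopy_equivalent (X Y : topologicalType) : Prop :=
  exists (f : X -> Y) (g : Y -> X),
    [/\ continuous f, continuous g,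
        homotopic (g \o f) idfun & homotopic (f \o g) idfun].

End Homotopy.

(* The library's measurable types are pointed, so the metric spaces on which
   measures are considered are required to be pointed too. *)
#[short(type="pmetricType")]
HB.structure Definition PointedMetric (K : numDomainType) :=
  {M of Metric K M & isPointed M}.

Notation borel T := (g_sigma_algebraType (@open T)).

Section AntiVietorisRips.
Context {R : realType} (X : pmetricType R).

(* [ereal_inf set0 = +oo], so that singletons have infinite spread. *)
Definition spread (A : set X) : \bar R :=
  ereal_inf [set (mdist p.1 p.2)%:E |
              p in [set p : X * X | [/\ A p.1, A p.2 & p.1 <> p.2]]].

(* A finitely supported function [mu] stands for the measure
   \sum_i lambda_i \delta_{x_i}, with the x_i the points of its support and
   lambda_i := mu x_i. *)
Definition fs_measure (mu : {fsfun X -> R with 0}) (A : set X) : \bar R :=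
  (\sum_(x <- finsupp mu) (mu x)%:E * (\d_(x : borel X) A))%E.

Definition coupling (mu nu : {fsfun X -> R with 0}) :
    set (probability (borel (X * X)%type) R) :=
  [set P | forall A : set X, measurable (A : set (borel X)) ->
     P (fst @^-1` A) = fs_measure mu A /\ P (snd @^-1` A) = fs_measure nu A].

Definition wasserstein1 (mu nu : {fsfun X -> R with 0}) : \bar R :=
  ereal_inf [set (\int[P]_z (mdist z.1 z.2)%:E)%E | P in coupling mu nu].

Record AVR (r : R) := MkAVR {
  avr_weight :> {fsfun X -> R with 0};
  avr_ge0 : forall x, 0 <= avr_weight x;
  avr_sum1 : \sum_(x <- finsupp avr_weight) avr_weight x = 1;
  avr_spread : (r%:E <= spread [set` finsupp avr_weight])%E }.

HB.instance Definition _ (r : R) := gen_eqMixin (AVR r).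
HB.instance Definition _ (r : R) := gen_choiceMixin (AVR r).

Section topology.
Variable r : R.

(* The topology of the metric W_1, through its open sets. *)
Definition AVR_open (U : set (AVR r)) : Prop :=
  forall mu, U mu -> exists2 e : R, 0 < e &
    forall nu : AVR r, (wasserstein1 mu nu < e%:E)%E -> U nu.

Let AVR_openT : AVR_open setT.
Proof. by move=> mu _; exists 1. Qed.

Let AVR_openI (U V : set (AVR r)) :
  AVR_open U -> AVR_open V -> AVR_open (U `&` V).
Proof.
move=> oU oV mu [/oU[d d0 dU] /oV[e e0 eV]].
exists (Num.min d e) => [|nu]; first by rewrite lt_min d0.
rewrite EFin_min lt_min => /andP[/dU Unu /eV Vnu].
by split.
Qed.

Let AVR_open_bigU (I : Type) (F : I -> set (AVR r)) :
  (forall i, AVR_open (F i)) -> AVR_open (\bigcup_i F i).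
Proof.
move=> oF mu [i _ /oF[e e0 eF]]; exists e => // nu /eF Fnu.
by exists i.
Qed.

HB.instance Definition _ := @isOpenTopological.Build (AVR r) AVR_open
  AVR_openT AVR_openI AVR_open_bigU.

End topology.

End AntiVietorisRips.

Section Dot.
Context {R : realType} {m : nat}.
Implicit Types u v w : 'rV[R]_m.

Definition dot u v : R := \sum_i u 0 i * v 0 i.

Lemma dotC u v : dot u v = dot v u.
Proof. by apply: eq_bigr => i _; rewrite mulrC. Qed.

Lemma dot_comb (a b : R) u v w :
  dot (a *: u + b *: v) w = a * dot u w + b * dot v w.
Proof.
rewrite /dot !mulr_sumr -big_split/=; apply: eq_bigr => i _.
by rewrite !mxE; ring.
Qed.

Lemma dotNN u v : dot (- u) (- v) = dot u v.
Proof. by apply: eq_bigr => i _; rewrite !mxE mulrNN. Qed.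

Lemma dot_ge0 u : 0 <= dot u u.
Proof. by apply: sumr_ge0 => i _; rewrite -expr2 sqr_ge0. Qed.

Lemma dot_eq0 u : dot u u = 0 -> u = 0.
Proof.
move=> u0; apply/rowP => i; rewrite mxE; apply/eqP.
rewrite -sqrf_eq0 expr2; apply/eqP.
have /psumr_eq0P : forall j : 'I_m, true -> 0 <= u 0 j * u 0 j.
  by move=> j _; rewrite -expr2 sqr_ge0.
by move=> /(_ u0); exact.
Qed.

Lemma dot_comb_sqr (a b : R) u v :
  dot (a *: u + b *: v) (a *: u + b *: v) =
  a ^+ 2 * dot u u + 2 * a * b * dot u v + b ^+ 2 * dot v v.
Proof.
by rewrite dot_comb !(dotC _ (_ + _)) !dot_comb (dotC v u); ring.
Qed.

Lemma dot_sqr_le u v : dot u v ^+ 2 <= dot u u * dot v v.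
Proof.
have [v0|v0] := eqVneq (dot v v) 0.
  have -> : dot u v = 0.
    by rewrite (dot_eq0 v0) /dot big1// => i _; rewrite mxE mulr0.
  by rewrite expr0n mulr_ge0 ?dot_ge0.
have vp : 0 < dot v v by rewrite lt_neqAle eq_sym v0 dot_ge0.
have := dot_ge0 (dot v v *: u + (- dot u v) *: v).
rewrite dot_comb_sqr => h; rewrite -subr_ge0 -(pmulr_rge0 _ vp).
by apply: le_trans h _; rewrite le_eqVlt; apply/orP; left; apply/eqP; ring.
Qed.

End Dot.

Record sphere (R : realType) (n : nat) := Sphere {
  sphere_val :> 'rV[R]_n.+1;
  _ : dot sphere_val sphere_val == 1 }.

Section Sphere.
Context {R : realType} {n : nat}.
Local Notation S := (sphere R n).
Implicit Types x y z : S.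

HB.instance Definition _ := [isSub for @sphere_val R n].
HB.instance Definition _ := [Choice of S by <:].

Lemma sphere_dotxx x : dot x x = 1.
Proof. by apply/eqP; exact: (valP x). Qed.

Lemma sphere_point_subproof :
  dot (delta_mx 0 0 : 'rV[R]_n.+1) (delta_mx 0 0) == 1.
Proof.
rewrite /dot (bigD1 ord0)//= big1 ?addr0 => [|i i0].
  by rewrite !mxE eqxx mulr1.
by rewrite !mxE (negbTE i0) andbF mulr0.
Qed.

HB.instance Definition _ := isPointed.Build S (Sphere sphere_point_subproof).

Lemma sphere_dot_itv x y : -1 <= dot x y <= 1.
Proof.
have := dot_ge0 (1 *: val x + 1 *: val y).
have := dot_ge0 (1 *: val x + (-1) *: val y).
rewrite !dot_comb_sqr !sphere_dotxx => ? ?; apply/andP; split; lra.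
Qed.

Definition geodesic x y : R := acos (dot x y).

Let geodesicxx x : geodesic x x = 0.
Proof. by rewrite /geodesic sphere_dotxx acos1. Qed.

Let cos_geodesic x y : cos (geodesic x y) = dot x y.
Proof. by apply: acosK; rewrite in_itv/=; exact: sphere_dot_itv. Qed.

Let geodesic_itv x y : 0 <= geodesic x y <= pi.
Proof. by rewrite acos_ge0 ?acos_lepi ?sphere_dot_itv. Qed.

Let geodesic_positivity x y : geodesic x y = 0 -> x = y.
Proof.
move=> xy0; have := cos_geodesic x y; rewrite xy0 cos0 => /esym xy1.
have /dot_eq0/eqP : dot (1 *: val x + (-1) *: val y)
    (1 *: val x + (-1) *: val y) = 0.
  by rewrite dot_comb_sqr !sphere_dotxx xy1; ring.
by rewrite scale1r scaleN1r subr_eq0 => /eqP; exact: val_inj.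
Qed.

Let geodesic_sym x y : geodesic x y = geodesic y x.
Proof. by rewrite /geodesic dotC. Qed.

Let geodesic_triangle y x z :
  geodesic x z <= geodesic x y + geodesic y z.
Proof.
have /andP[a0 api] := geodesic_itv x y.
have /andP[b0 bpi] := geodesic_itv y z.
have /andP[c0 cpi] := geodesic_itv x z.
have [abpi|/ltW abpi] := leP (geodesic x y + geodesic y z) pi; last first.
  exact: le_trans abpi.
rewrite leNgt -ltr_cos ?in_itv/= ?c0 ?addr_ge0// -leNgt cosD !cos_geodesic.
rewrite !sin_acos ?sphere_dot_itv//.
have xyz : (dot x z - dot x y * dot y z) ^+ 2 <=
    (1 - dot x y ^+ 2) * (1 - dot y z ^+ 2).
  have := dot_sqr_le (1 *: val x + (- dot x y) *: val y)
                     (1 *: val z + (- dot y z) *: val y).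
  rewrite !dot_comb_sqr !dot_comb !(dotC _ (_ + _)) !dot_comb !sphere_dotxx.
  rewrite (dotC z y) (dotC z x) (dotC y x) => h.
  by move: h; congr (_ <= _); ring.
have := ler_wsqrtr xyz; rewrite sqrtr_sqr sqrtrM; last first.
  by have /andP[? ?] := sphere_dot_itv x y; nra.
by rewrite ler_norml => /andP[+ _]; lra.
Qed.

HB.instance Definition _ := @isMetric.Build R S geodesic
  geodesicxx geodesic_positivity geodesic_sym geodesic_triangle.

Lemma antipode_subproof x : dot (- val x) (- val x) == 1.
Proof. by rewrite dotNN sphere_dotxx. Qed.

Definition antipode x : S := Sphere (antipode_subproof x).

Lemma antipodeK : involutive antipode.
Proof. by move=> x; apply: val_inj; rewrite /= opprK. Qed.

Definition antipodal x y : bool := (y == x) || (y == antipode x).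

Lemma antipodal_equiv : equiv_class_of antipodal.
Proof.
split=> [x|x y|y x z]; rewrite /antipodal.
- by rewrite eqxx.
- by rewrite eq_sym [y == _]eq_sym (can2_eq antipodeK antipodeK).
- move=> /orP[]/eqP->; move=> /orP[]/eqP->; rewrite ?antipodeK ?eqxx ?orbT//.
Qed.

Canonical antipodal_equivRel := EquivRelPack antipodal_equiv.

End Sphere.

(* The sphere has the topology of its geodesic metric here. *)
Definition RP (R : realType) (n : nat) :=
  quotient_topology {eq_quot (@antipodal R n)}%qT.

HB.instance Definition _ R n := Topological.on (RP R n).

(* Main.v *)
(* Three points of the sphere at pairwise distance > 2 pi / 3 have pairwise
   inner products < - 1 / 2, so their sum would have a negative squared norm.
   Hence every measure in AVR has the form (1 - t) \delta_x + t \delta_y, and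
   AVR is the image of the compact space K of triples (x, y, t) with x, y at
   distance >= r and 0 <= t <= 1.  Explicit couplings show that K -> AVR is
   continuous, and AVR is Hausdorff because integration of Lipschitz functions
   is continuous for W_1; so K -> AVR is a quotient map, and so is its product
   with [0, 1].  Continuity of maps out of AVR is thus checked on K.
   The map to RP sends (x, y, t) to the line of (1 - t) x - t y, which is
   nonzero since <x, y> < 0; the map back sends the line of z to
   (\delta_z + \delta_(-z)) / 2.  One composite is the identity.  The other is
   deformed to the identity by first sliding x and y, inside their plane and
   without decreasing their distance, to the two unit vectors of the line, and
   only then moving the weight to 1 / 2: in this order the point of weight 0
   in a Dirac measure, which is not determined by the measure, never matters. *)

Require Import Defs.
From HB Require Import structures.
From mathcomp Require Import all_boot all_order all_algebra generic_quotient.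
From mathcomp Require Import finmap.
From mathcomp Require Import ring lra.
From mathcomp Require Import measurable_realfun.
From mathcomp Require Import all_classical all_reals all_analysis.

Set Implicit Arguments.
Unset Strict Implicit.
Unset Printing Implicit Defensive.

Import Order.TTheory GRing.Theory Num.Theory.
Import numFieldNormedType.Exports.
Local Open Scope classical_set_scope.
Local Open Scope ring_scope.

(** * Quotient maps from compact sets *)

Lemma hausdorff_separating (T U : topologicalType) : hausdorff_space U ->
  (forall x y : T, x <> y ->
    exists2 phi : T -> U, continuous phi & phi x <> phi y) ->
  hausdorff_space T.
Proof.
move=> hU sep p q pq; apply: contrapT => /sep[phi cphi]; apply; apply: hU.
move=> A B /cphi pA /cphi qB; have [z [Az Bz]] := pq _ _ pA qB.
by exists (phi z).
Qed.

(* The restriction of [q] to [K] is a closed map onto its image, hence a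
   quotient map. *)
Lemma within_image_continuous (T Y Z : topologicalType) (K : set T)
    (q : T -> Y) (F : Y -> Z) :
  hausdorff_space Y -> compact K -> {within K, continuous q} ->
  {within K, continuous (F \o q)} -> {within q @` K, continuous F}.
Proof.
move=> hY cK cq /continuous_closedP cF; apply/continuous_closedP => C /cF.
move=> /closed_subspaceP[W cW WK]; apply/closed_subspaceP.
(* [W] is closed and cuts out on [K] the preimage of [C] under [F \o q]. The image of [W] inside [K]
   is compact, hence closed because [Y] is Hausdorff. *)
exists (q @` (W `&` K)).
  apply: compact_closed => //; apply: continuous_compact.
    by apply: continuous_subspaceW cq => ? [].
  by rewrite setIC; exact: compact_closedI.
rewrite WK; apply/seteqP; split=> [y [[k [Ck Kk] <-] _]|y [Cy [k Kk ky]]].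
  by split => //; exists k.
by subst y; split; exists k.
Qed.

Lemma within_comp_continuous (T Y Z : topologicalType) (A : set T) (B : set Y)
    (f : T -> Y) (g : Y -> Z) :
  (forall x, A x -> B (f x)) -> (forall x, A x -> {for x, continuous f}) ->
  {within B, continuous g} -> {within A, continuous (g \o f)}.
Proof.
move=> AB cf /subspace_continuousP cg; apply/subspace_continuousP => x Ax.
move=> V /(cg _ (AB _ Ax)) gV; have := cf _ Ax _ gV.
by rewrite /within /= !nbhs_simpl /=; apply: filterS => y h /AB; exact: h.
Qed.

Lemma hausdorff_setX (T U : topologicalType) :
  hausdorff_space T -> hausdorff_space U -> hausdorff_space (T * U)%type.
Proof.
move=> hT hU [x y] [x' y'] xy; congr pair.
  apply: hT => A B xA x'B.
  have [[a b] [Aa Ba]] := xy _ _ (cvg_fst xA) (cvg_fst x'B).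
  by exists a.
apply: hU => A B yA y'B.
have [[a b] [Ab Bb]] := xy _ _ (cvg_snd yA) (cvg_snd y'B).
by exists b.
Qed.

(* [cvg_pair] with neighbourhood filters as targets: on spheres, unification
   does not find that these are filters. *)
Lemma cvg_pair_nbhs {T : Type} {F : set_system T} {FF : Filter F}
    (U V : topologicalType) (f : T -> U) (g : T -> V) (x : U) (y : V) :
  f @ F --> x -> g @ F --> y -> (fun t => (f t, g t)) @ F --> (x, y).
Proof. exact: cvg_pair. Qed.

(** * Estimates of the Wasserstein distance *)

(** Open rays generate the Borel sets of the line, and their preimages are generators on the
    left. *)
Lemma open_preimage_measurable {R : realType} (T : pointedType)
    (G : set (set T)) (f : T -> R) :
  (forall A, open A -> G (f @^-1` A)) ->
  measurable_fun setT (f : g_sigma_algebraType G -> R).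
Proof.
move=> Gf.
apply: (measurability _ (RGenOInfty.measurableE R)) => _ [_ [a ->] <-].
rewrite setTI; apply: sub_sigma_algebra; apply: Gf; exact: interval_open.
Qed.

Section dirac_combination.
Context {d} {T : measurableType d} {R : realType}.
Variables (w : nat -> {nonneg R}) (a : nat -> T) (n : nat).

(** The normalisation proof is an argument, so that the structure of probability measure can be
    attached to the term. *)
Definition dirac_comb of \sum_(i < n) (w i)%:num = 1 : set T -> \bar R :=
  msum (fun i => mscale (w i) (dirac (a i))) n.

Hypothesis w1 : \sum_(i < n) (w i)%:num = 1.

HB.instance Definition _ := Measure.on (dirac_comb w1).

Lemma dirac_combE A :
  dirac_comb w1 A = (\sum_(i < n) (w i)%:num * \1_A (a i))%:E.
Proof.
by rewrite -sumEFin; apply: eq_bigr => i _; rewrite EFinM.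
Qed.

Let dirac_comb_setT : dirac_comb w1 setT = 1%E.
Proof.
rewrite dirac_combE -w1; congr EFin; apply: eq_bigr => i _.
by rewrite indicT mulr1.
Qed.

HB.instance Definition _ :=
  Measure_isProbability.Build _ _ _ (dirac_comb w1) dirac_comb_setT.

Lemma integral_dirac_comb (f : T -> R) :
  measurable_fun setT f -> (forall x, 0 <= f x) ->
  (\int[dirac_comb w1]_x (f x)%:E)%E = (\sum_(i < n) (w i)%:num * f (a i))%:E.
Proof.
move=> mf f0; rewrite ge0_integral_measure_sum//; last 2 first.
- by move=> x _; rewrite lee_fin.
- exact/measurable_EFinP.
rewrite -sumEFin; apply: eq_bigr => i _.
rewrite ge0_integral_mscale//; last 2 first.
- exact/measurable_EFinP.
- by move=> x _; rewrite lee_fin.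
rewrite integral_dirac//; last exact/measurable_EFinP.
by rewrite diracT mul1e EFinM.
Qed.

End dirac_combination.

Section wasserstein.
Context {R : realType} {X : pmetricType R}.
Implicit Types (mu nu : {fsfun X -> R with 0}) (h : X -> R).

Lemma mdist_fst_snd_continuous : continuous (fun z : X * X => mdist z.1 z.2).
Proof.
move=> [x y]; apply/cvgrPdist_lt => e e0.
have e20 : 0 < e / 2 by rewrite divr_gt0.
exists (ball x (e / 2), ball y (e / 2)) => /=.
  by split; exact: nbhsx_ballx.
move=> [x' y'] /= [+ +]; rewrite !ballEmdist /= => xx' yy'.
have := metric_triangle x x' y; have := metric_triangle x' y' y.
have := metric_triangle x' x y'; have := metric_triangle x y y'.
rewrite (metric_sym y' y) (metric_sym x' x) ltr_norml => *.
by apply/andP; split; lra.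
Qed.

Lemma lipschitz_fun_continuous (k : R) h : 0 < k ->
  (forall x y, h x <= h y + k * mdist x y) -> continuous h.
Proof.
move=> k0 hk x; apply/cvgrPdist_lt => e e0.
apply/nbhs_ballP; exists (e / k) => /=; first exact: divr_gt0.
move=> y; rewrite ballEmdist /= ltr_pdivlMr// mulrC => xy.
have := hk x y; have := hk y x; rewrite (metric_sym y x) ltr_norml => *.
by apply/andP; split; lra.
Qed.

Lemma continuous_measurable_borelX (f : X * X -> X) :
  continuous f -> measurable_fun setT (f : borel (X * X)%type -> borel X).
Proof.
move=> /continuousP cf.
apply: (@measurability _ _ _ (borel X) _ _ open) => // _ [B oB <-].
by rewrite setTI; apply: sub_sigma_algebra; exact: cf.
Qed.

Definition expect h mu : R := \sum_(x <- finsupp mu) mu x * h x.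

(** The pushforward of [P] by [f] agrees on measurable sets with the Dirac combination over the
    support of [mu], so the integral is a finite sum. For a coupling, [f] is one of the two
    projections. *)
Lemma integral_fs_marginal d (T : measurableType d)
    (P : {measure set T -> \bar R}) (f : T -> borel X) mu h :
  measurable_fun setT f ->
  (forall x, 0 <= mu x) -> \sum_(x <- finsupp mu) mu x = 1 ->
  (forall A : set X, measurable (A : set (borel X)) ->
    P (f @^-1` A) = fs_measure mu A) ->
  continuous h -> (forall x, 0 <= h x) ->
  (\int[P]_z (h (f z))%:E)%E = (expect h mu)%:E.
Proof.
move=> mf mu0 mu1 PE ch h0.
have mh : measurable_fun setT (h : borel X -> R).
  by apply: open_preimage_measurable; exact/continuousP.
pose f' : {mfun _ >-> _} := HB.pack f (isMeasurableFun.Build _ _ _ _ _ mf).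
pose a i : borel X := nth point (finsupp mu) i.
pose w i : {nonneg R} := NngNum (mu0 (a i)).
have w1 : \sum_(i < size (finsupp mu)) (w i)%:num = 1.
  by rewrite -mu1 (big_nth point) big_mkord.
transitivity (\int[pushforward P f']_x (h x)%:E)%E.
  rewrite (ge0_integral_pushforward mf)//; first exact/measurable_EFinP.
  by move=> y _; rewrite lee_fin.
transitivity (\int[dirac_comb a w1]_x (h x)%:E)%E; last first.
  rewrite integral_dirac_comb//.
  by rewrite /expect (big_nth point) big_mkord.
apply: eq_measure_integral => A mA _.
apply: etrans (PE _ mA) _; apply: etrans; last exact/esym/dirac_combE.
rewrite /fs_measure (big_nth point) big_mkord -sumEFin.
by apply: eq_bigr => i _.
Qed.

(** The easy half of Kantorovich-Rubinstein duality: integrate the Lipschitz inequality against a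
    coupling of cost below [e]. *)
Lemma wasserstein1_expect mu nu h (k e : R) :
  (forall x, 0 <= mu x) -> \sum_(x <- finsupp mu) mu x = 1 ->
  (forall x, 0 <= nu x) -> \sum_(x <- finsupp nu) nu x = 1 ->
  0 < k -> (forall x, 0 <= h x) ->
  (forall x y, h x <= h y + k * mdist x y) ->
  (wasserstein1 mu nu < e%:E)%E -> `|expect h mu - expect h nu| <= k * e.
Proof.
move=> mu0 mu1 nu0 nu1 k0 h0 hk.
move=> /ereal_inf_lt[_ [P PE <-] Pe].
have ch := lipschitz_fun_continuous k0 hk.
have Pmu : (\int[P]_z (h z.1)%:E)%E = (expect h mu)%:E.
  apply: (@integral_fs_marginal _ _ P fst mu h) => // [|A /PE[]//].
  by apply: (@continuous_measurable_borelX fst) => ?; exact: cvg_fst.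
have Pnu : (\int[P]_z (h z.2)%:E)%E = (expect h nu)%:E.
  apply: (@integral_fs_marginal _ _ P snd nu h) => // [|A /PE[]//].
  by apply: (@continuous_measurable_borelX snd) => ?; exact: cvg_snd.
have mh1 : measurable_fun setT (fun z : borel (X * X)%type => h z.1).
  apply: open_preimage_measurable; apply/continuousP => z.
  by apply: continuous_comp; [exact: cvg_fst|exact: ch].
have mh2 : measurable_fun setT (fun z : borel (X * X)%type => h z.2).
  apply: open_preimage_measurable; apply/continuousP => z.
  by apply: continuous_comp; [exact: cvg_snd|exact: ch].
have md : measurable_fun setT
    (fun z : borel (X * X)%type => (mdist z.1 z.2)%:E : \bar R).
  apply/measurable_EFinP.
  apply: open_preimage_measurable; apply/continuousP.
  exact: mdist_fst_snd_continuous.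
have kd : (\int[P]_z (k%:E * (mdist z.1 z.2)%:E) <= (k * e)%:E)%E.
  rewrite ge0_integralZl_EFin//; last 2 first.
  - by move=> z _; rewrite lee_fin mdist_ge0.
  - exact: ltW.
  by rewrite EFinM; apply: lee_wpmul2l; [rewrite lee_fin ltW|exact: ltW].
have mkd : measurable_fun setT
    (fun z : borel (X * X)%type => (k%:E * (mdist z.1 z.2)%:E)%E : \bar R).
  exact: measurable_funeM.
have kd0 z : (0 <= k%:E * (mdist z.1 z.2)%:E :> \bar R)%E.
  by rewrite -EFinM lee_fin mulr_ge0 ?mdist_ge0 ?ltW.
(* Everything is nonnegative, so the extended integrals add without integrability. This is applied
   twice, with the roles of the two marginals exchanged. *)
have le_int (f g : X * X -> R) :
    measurable_fun setT (f : borel (X * X)%type -> R) ->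
    measurable_fun setT (g : borel (X * X)%type -> R) ->
    (forall z, 0 <= f z) -> (forall z, 0 <= g z) ->
    (forall z, f z <= g z + k * mdist z.1 z.2) ->
    (\int[P]_z (f z)%:E <= \int[P]_z (g z)%:E + (k * e)%:E)%E.
  move=> mf mg f0 g0 fg; apply: le_trans (leeD2l _ kd).
  rewrite -ge0_integralD//; last 2 first.
  - by move=> z _; rewrite lee_fin.
  - exact/measurable_EFinP.
  apply: ge0_le_integral => //.
  - by move=> z _; rewrite lee_fin.
  - exact/measurable_EFinP.
  - by apply: emeasurable_funD => //; exact/measurable_EFinP.
  - by move=> z _; rewrite -EFinM -EFinD lee_fin.
have := le_int _ _ mh1 mh2 (fun=> h0 _) (fun=> h0 _) (fun z => hk z.1 z.2).
have := le_int _ _ mh2 mh1 (fun=> h0 _) (fun=> h0 _).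
rewrite Pmu Pnu -!EFinD !lee_fin => /(_ _) nu_mu mu_nu.
rewrite ler_norml; apply/andP; split; last by lra.
have : expect h nu <= expect h mu + k * e.
  by apply: nu_mu => z; rewrite metric_sym.
by lra.
Qed.

End wasserstein.

(** * Measures supported on two points *)

Section two_points.
Context {R : realType} {X : pmetricType R}.
Implicit Types (x y : X) (t r : R).

Lemma fs_measureE (mu : {fsfun X -> R with 0}) A :
  fs_measure mu A = (expect \1_A mu)%:E.
Proof. by rewrite /expect -sumEFin; apply: eq_bigr => x _; rewrite EFinM. Qed.

Lemma AVR_eqP r (mu nu : AVR X r) :
  (forall x, avr_weight mu x = avr_weight nu x) -> mu = nu.
Proof.
case: mu nu => [m m0 m1 mr] [n n0 n1 nr] /= mn.
have {}mn : m = n by apply/fsfunP.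
subst n; congr MkAVR; exact: Prop_irrelevance.
Qed.

Lemma expect_continuous r (h : X -> R) :
  (forall x, 0 <= h x) -> (forall x y, h x <= h y + mdist x y) ->
  continuous (fun mu : AVR X r => expect h mu).
Proof.
move=> h0 h1; apply/continuousP => U oU.
change (AVR_open ((fun mu : AVR X r => expect h mu) @^-1` U)) => mu Umu.
have [e e0 eU] : exists2 e : R, 0 < e & ball (expect h mu) e `<=` U.
  by have /nbhs_ballP[e /= e0 eU] := open_nbhs_nbhs (conj oU Umu); exists e.
(* [wasserstein1_expect] gives a non-strict bound; halving [e] makes it strict. *)
exists (e / 2) => [|nu munu]; first exact: divr_gt0.
apply: eU; rewrite /ball/=.
apply: (@le_lt_trans _ _ (1 * (e / 2))); last first.
  by rewrite mul1r ltr_pdivrMr// ltr_pMr// ltr1n.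
apply: wasserstein1_expect munu => //; try exact: avr_ge0; try exact: avr_sum1.
by move=> x y; rewrite mul1r.
Qed.

Lemma mdist_separated x (s : seq X) :
  exists2 e : R, 0 < e & forall y, y \in s -> y != x -> e <= mdist y x.
Proof.
elim: s => [|z s [e e0 es]]; first by exists 1.
have [->|zx] := eqVneq z x.
  exists e => // y; rewrite inE => /orP[/eqP->|/es//].
  by rewrite eqxx.
exists (Num.min e (mdist z x)) => [|y]; first by rewrite lt_min e0 mdist_gt0.
rewrite inE ge_min => /orP[/eqP->|/es h /h ->//]; first by rewrite lexx orbT.
Qed.

(** Two distinct measures differ in weight at some [a]. The tent function of height [e] at [a], with
    [e] at most the distance from [a] to every other support point of both, integrates to [e] times
    that weight, and its integral is continuous. *)
Lemma AVR_hausdorff r : hausdorff_space (AVR X r).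
Proof.
apply: (@hausdorff_separating _ R); first exact: norm_hausdorff.
move=> mu nu munu.
have [a ma] : exists a, avr_weight mu a <> avr_weight nu a.
  by apply/existsNP => mn; apply: munu; exact: AVR_eqP.
have [e e0 es] := mdist_separated a (finsupp mu ++ finsupp nu).
pose h x := Num.max 0 (e - mdist x a).
have hmu (rho : AVR X r) :
    {subset finsupp rho <= (finsupp mu ++ finsupp nu : seq X)} ->
    expect h rho = avr_weight rho a * e.
  move=> sub.
  have hz z : z \in finsupp rho -> z != a -> avr_weight rho z * h z = 0.
    move=> zr za; rewrite /h max_l ?mulr0// subr_le0.
    by apply: es => //; exact: sub.
  have ha : h a = e by rewrite /h mdistxx subr0 max_r// ltW.
  rewrite /expect; have [ar|ar] := boolP (a \in finsupp rho).
    rewrite (big_fsetD1 a)//= ha big1_seq ?addr0// => z /=.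
    by rewrite !inE => /andP[za zr]; exact: hz.
  rewrite big1_seq => [|z /= zr]; first by rewrite fsfun_dflt ?mul0r.
  by apply: hz => //; apply: contraNneq ar => <-.
exists (fun rho : AVR X r => expect h rho).
  apply: expect_continuous => [x|x y]; first by rewrite /h le_max lexx.
  rewrite /h; have := metric_triangle y x a; have := mdist_ge0 x y.
  rewrite (metric_sym y x); have [?|?] := leP 0 (e - mdist x a);
  by have [?|?] := leP 0 (e - mdist y a); lra.
rewrite !hmu; last 2 first.
- by move=> z zn; rewrite mem_cat; apply/orP; right.
- by move=> z zm; rewrite mem_cat; apply/orP; left.
by move=> /mulIf mn; apply/ma/mn; rewrite gt_eqF.
Qed.

(** This is $(1-t)\delta_x + t\delta_y$ when [x] and [y] differ; for [x = y] the mass would be only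
    [1 - t]. *)
Definition pair_weight x y t : {fsfun X -> R with 0} :=
  [fsfun z in [fset x; y]%fset => if z == x then 1 - t else t | 0].

Lemma pair_weightE x y t z :
  pair_weight x y t z =
  if z == x then 1 - t else if z == y then t else 0.
Proof.
rewrite /pair_weight fsfun_fun !inE.
by case: eqP => //; case: eqP.
Qed.

Lemma expect_pair x y t (h : X -> R) : x != y ->
  expect h (pair_weight x y t) = (1 - t) * h x + t * h y.
Proof.
move=> xy; rewrite /expect.
(* At [t = 0] or [t = 1] the support is smaller than the pair; the added terms vanish. *)
rewrite (@big_fset_incl _ _ _ _ _ [fset x; y]%fset); last 2 first.
- exact: finsupp_sub.
- by move=> z _ zN; rewrite fsfun_dflt// mul0r.
rewrite big_fsetU1 ?inE//= big_seq_fset1 !pair_weightE eqxx.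
by rewrite eq_sym (negbTE xy) eqxx.
Qed.

Lemma sum_pair x y t : x != y ->
  \sum_(z <- finsupp (pair_weight x y t)) pair_weight x y t z = 1.
Proof.
move=> xy; have := expect_pair t (fun=> 1) xy.
rewrite /expect !mulr1 subrK => <-.
by apply: eq_bigr => z _; rewrite mulr1.
Qed.

(** The coupling leaves as much mass as possible on [(x, x')] and [(y, y')]; only the excess
    [|t - t'|] crosses, to [(x, y')] or [(y, x')]. *)
Lemma wasserstein1_pair x y t x' y' t' :
  x != y -> x' != y' -> 0 <= t <= 1 -> 0 <= t' <= 1 ->
  (wasserstein1 (pair_weight x y t) (pair_weight x' y' t') <=
   (mdist x x' + mdist y y' + `|t - t'| * (mdist x y' + mdist y x'))%:E)%E.
Proof.
move=> xy xy' /andP[t0 t1] /andP[t'0 t'1].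
have v0 : 0 <= Num.min (1 - t) (1 - t') by rewrite le_min !subr_ge0 t1.
have v1 : 0 <= Num.min t t' by rewrite le_min t0.
have v2 : 0 <= Num.max (t' - t) 0 by rewrite le_max lexx orbT.
have v3 : 0 <= Num.max (t - t') 0 by rewrite le_max lexx orbT.
have tt' : (Num.min (1 - t) (1 - t') = 1 - t' /\ Num.min t t' = t /\
    Num.max (t' - t) 0 = t' - t /\ Num.max (t - t') 0 = 0 /\ `|t - t'| = t' - t)
    \/ (Num.min (1 - t) (1 - t') = 1 - t /\ Num.min t t' = t' /\
    Num.max (t' - t) 0 = 0 /\ Num.max (t - t') 0 = t - t' /\
    `|t - t'| = t - t').
  have /orP[le|le] := le_total t t'; [left|right].
    rewrite (min_r (_ : 1 - t' <= 1 - t)); last by lra.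
    rewrite (min_l le) (max_l (_ : 0 <= t' - t)); last by lra.
    rewrite (max_r (_ : t - t' <= 0)); last by lra.
    by rewrite ler0_norm ?opprB//; lra.
  rewrite (min_l (_ : 1 - t <= 1 - t')); last by lra.
  rewrite (min_r le) (max_r (_ : t' - t <= 0)); last by lra.
  rewrite (max_l (_ : 0 <= t - t')); last by lra.
  by rewrite ger0_norm//; lra.
move: v0 v1 v2 v3 tt'.
(* Once [tt'] records their values in both orders of [t] and [t'], the minima and maxima become
   variables, which leaves plain arithmetic. *)
move: (Num.min (1 - t) (1 - t')) (Num.min t t') (Num.max (t' - t) 0)
  (Num.max (t - t') 0) `|t - t'|.
move=> u0 u1 u2 u3 u4 v0 v1 v2 v3 tt'.
pose w (i : nat) : {nonneg R} := match i with
  | 0 => NngNum v0 | 1 => NngNum v1 | 2 => NngNum v2 | _ => NngNum v3 end.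
pose a (i : nat) : borel (X * X)%type := match i with
  | 0 => (x, x') | 1 => (y, y') | 2 => (x, y') | _ => (y, x') end.
have w1 : \sum_(i < 4) (w i)%:num = 1.
  by rewrite !big_ord_recr big_ord0 /=; lra.
apply: (@le_trans _ _ (\int[dirac_comb a w1]_z (mdist z.1 z.2)%:E)%E).
  apply: ereal_inf_lbound; exists (dirac_comb a w1) => // A mA.
  have ind (f : X * X -> X) z : \1_(f @^-1` A) z = \1_A (f z) :> R by [].
  rewrite !fs_measureE !expect_pair//.
  split; apply: etrans (dirac_combE a w1 _) _; congr EFin;
    rewrite !big_ord_recr big_ord0 /= !ind /=;
    by case: tt' => -[-> [-> [-> [-> _]]]]; ring.
rewrite integral_dirac_comb => [||z]; last 2 first.
- apply: open_preimage_measurable.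
  exact/continuousP/mdist_fst_snd_continuous.
- exact: mdist_ge0.
rewrite !big_ord_recr big_ord0 /= lee_fin.
have := mdist_ge0 x x'; have := mdist_ge0 y y'.
have := mdist_ge0 x y'; have := mdist_ge0 y x'.
move: (mdist x x') (mdist y y') (mdist x y') (mdist y x') => d0 d1 d2 d3.
move=> d3_ge0 d2_ge0 d1_ge0 d0_ge0.
have [u0_le1 [u1_le1 u4E]] : u0 <= 1 /\ u1 <= 1 /\ u4 = u2 + u3 by lra.
have := ler_piMl d0_ge0 u0_le1; have := ler_piMl d1_ge0 u1_le1.
have := mulr_ge0 v2 d3_ge0; have := mulr_ge0 v3 d2_ge0.
by rewrite u4E; lra.
Qed.

(** The weights 0 and 1 are included to keep this parameter space closed, at the price of several
    parameters for one Dirac measure. *)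
Definition far_pairs r : set (X * X * R) :=
  [set p | r <= mdist p.1.1 p.1.2 /\ 0 <= p.2 <= 1].

Lemma far_pairs_neq r p : 0 < r -> far_pairs r p -> p.1.1 != p.1.2.
Proof. by move=> r0 [rp _]; rewrite -mdist_gt0 (lt_le_trans r0). Qed.

(** The hypotheses stand under the existential so that [two_point] is a total function; off
    [far_pairs r] the Dirac measure at [point] is the witness. *)
Lemma exists_pair_AVR r p : exists mu : AVR X r,
  0 < r -> far_pairs r p -> avr_weight mu = pair_weight p.1.1 p.1.2 p.2.
Proof.
have [[r0 Kp]|nK] := pselect (0 < r /\ far_pairs r p).
  have xy := far_pairs_neq r0 Kp.
  case: p Kp xy => -[x y] t /= [rxy /andP[t0 t1]] /= xy.
  have mu0 z : 0 <= pair_weight x y t z.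
    by rewrite pair_weightE; do ![case: ifP => _]; rewrite ?subr_ge0.
  have mur : (r%:E <= spread [set` finsupp (pair_weight x y t)])%E.
    apply: le_ereal_inf_tmp => _ [[z z'] /= [zs z's zz'] <-].
    have := fsubsetP (finsupp_sub _ _ _) z zs.
    have := fsubsetP (finsupp_sub _ _ _) z' z's.
    rewrite !inE => /orP[]/eqP ? /orP[]/eqP ?; subst => //=.
    by rewrite metric_sym.
  by exists (MkAVR mu0 (sum_pair t xy) mur).
pose delta : {fsfun X -> R with 0} := [fsfun z in [fset point]%fset => 1 | 0].
have deltaE z : delta z = if z == point then 1 else 0.
  by rewrite /delta fsfun_fun !inE.
have sdelta z : z \in finsupp delta -> z = point.
  by rewrite mem_finsupp deltaE; case: (z =P point) => // _; rewrite eqxx.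
have mu0 z : 0 <= delta z by rewrite deltaE; case: ifP.
have mu1 : \sum_(z <- finsupp delta) delta z = 1.
  rewrite (@big_fset_incl _ _ _ _ _ [fset point]%fset).
  - by rewrite big_seq_fset1 deltaE eqxx.
  - exact: finsupp_sub.
  - by move=> z _ zN; rewrite fsfun_dflt.
have mur : (r%:E <= spread [set` finsupp delta])%E.
  apply: le_ereal_inf_tmp => _ [[z z'] /= [/sdelta -> /sdelta -> //]].
by exists (MkAVR mu0 mu1 mur) => r0 Kp; case: nK.
Qed.

(* An arbitrary measure if [p] is not in [far_pairs r]. *)
Definition two_point r p : AVR X r := projT1 (cid (exists_pair_AVR r p)).

Lemma two_pointE r p : 0 < r -> far_pairs r p ->
  avr_weight (two_point r p) = pair_weight p.1.1 p.1.2 p.2.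
Proof. exact: (projT2 (cid (exists_pair_AVR r p))). Qed.

Lemma two_point_continuous r : 0 < r ->
  {within far_pairs r, continuous (two_point r)}.
Proof.
move=> r0; apply/subspace_continuousP => -[[x y] t] Kp U.
rewrite nbhsE => -[V [oV Vp] VU].
have [e e0 eV] : exists2 e : R, 0 < e & forall nu : AVR X r,
    (wasserstein1 (two_point r (x, y, t)) nu < e%:E)%E -> V nu := oV _ Vp.
(* Within distance [d <= 1] the two crossing distances add up to at most [D - 3], so the cost is
   below [2 * d + d * (D - 3)], which is less than [d * D <= e]. *)
pose D := 2 * mdist x y + 5.
have D0 : 0 < D by rewrite /D; have := mdist_ge0 x y; lra.
pose d := Num.min 1 (e / D).
have d0 : 0 < d by rewrite lt_min ltr01 divr_gt0.
have dD : d * D <= e by rewrite -ler_pdivlMr// ge_min lexx orbT.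
have d1 : d <= 1 by rewrite ge_min lexx.
exists (ball x d `*` ball y d, ball t d).
  split => /=; last exact: nbhsx_ballx.
  by exists (ball x d, ball y d) => //; split; exact: nbhsx_ballx.
move=> [[x' y'] t'] /= [[]]; rewrite !ballEmdist /= => xx' yy'.
rewrite /ball /= => tt' Kp'; apply/VU/eV; rewrite !two_pointE//=.
apply: le_lt_trans (wasserstein1_pair _ _ _ _) _.
- exact: (far_pairs_neq r0 Kp).
- exact: (far_pairs_neq r0 Kp').
- exact: Kp.2.
- exact: Kp'.2.
rewrite lte_fin.
have sumD : mdist x y' + mdist y x' <= D - 3.
  have := metric_triangle x y y'; have := metric_triangle y x x'.
  by rewrite (metric_sym y x) /D; lra.
have sum0 : 0 <= mdist x y' + mdist y x' by rewrite addr_ge0 ?mdist_ge0.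
have := ler_pM (normr_ge0 (t - t')) sum0 (ltW tt') sumD.
by lra.
Qed.

Lemma far_pairs_swap r x y t :
  far_pairs r (x, y, t) -> far_pairs r (y, x, 1 - t).
Proof.
by case=> /= rxy /andP[t0 t1]; split; rewrite /= 1?metric_sym//; lra.
Qed.

Lemma two_point_swap r x y t : 0 < r -> far_pairs r (x, y, t) ->
  two_point r (x, y, t) = two_point r (y, x, 1 - t).
Proof.
move=> r0 Kp; have /= xy := far_pairs_neq r0 Kp.
apply: AVR_eqP => z; rewrite !two_pointE//=; last exact: far_pairs_swap.
rewrite !pair_weightE subKr; have [->|//] := eqVneq z x.
by rewrite (negbTE xy).
Qed.

Lemma two_point_pole r x y y' : 0 < r ->
  far_pairs r (x, y, 0) -> far_pairs r (x, y', 0) ->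
  two_point r (x, y, 0) = two_point r (x, y', 0).
Proof.
move=> r0 Kp Kp'; apply: AVR_eqP => z; rewrite !two_pointE//= !pair_weightE.
by rewrite !if_same.
Qed.

(* The measures [(1 - t) \delta_x + t \delta_y] coincide only through the swap
   of the two points and through the free choice of [y] when [t = 0]. *)
Lemma two_point_descend r (Z : Type) (F : X * X * R -> Z) : 0 < r ->
  (forall x y t, far_pairs r (x, y, t) -> F (x, y, t) = F (y, x, 1 - t)) ->
  (forall x y y', far_pairs r (x, y, 0) -> far_pairs r (x, y', 0) ->
    F (x, y, 0) = F (x, y', 0)) ->
  forall p p', far_pairs r p -> far_pairs r p' ->
    two_point r p = two_point r p' -> F p = F p'.
Proof.
move=> r0 Fswap Fpole.
(* The weight of the common first point gives [t = t']. If [t] is nonzero, [y] carries weight and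
   must equal [y']; otherwise [Fpole] applies. *)
have same_first x y t y' t' : t != 1 -> far_pairs r (x, y, t) ->
    far_pairs r (x, y', t') ->
    two_point r (x, y, t) = two_point r (x, y', t') ->
    F (x, y, t) = F (x, y', t').
  move=> t1 Kp Kp' pp'; have /= xy := far_pairs_neq r0 Kp.
  have E z : pair_weight x y t z = pair_weight x y' t' z.
    by have := congr1 (@avr_weight _ _ _) pp'; rewrite !two_pointE// => ->.
  have := E x; rewrite !pair_weightE eqxx => /(congr1 (fun u => 1 - u)).
  rewrite !subKr => tt'; subst t'.
  have [t0|t0] := eqVneq t 0; first by subst t; exact: Fpole.
  have := E y; rewrite !pair_weightE eq_sym (negbTE xy) eqxx.
  by case: eqP => [->//|_ /eqP]; rewrite (negbTE t0).
(* Here [x] has nonzero weight, so it is one of the two points of [p'], and is the first one up to a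
   swap. *)
have first_neq1 x y t p' : t != 1 -> far_pairs r (x, y, t) ->
    far_pairs r p' -> two_point r (x, y, t) = two_point r p' ->
    F (x, y, t) = F p'.
  case: p' => -[x' y'] t' t1 Kp Kp' pp'.
  have := congr1 (fun mu : AVR X r => avr_weight mu x) pp'.
  rewrite !two_pointE//= !pair_weightE eqxx.
  have [?|_] := eqVneq x x'; first by subst x' => _; exact: same_first pp'.
  have [?|_] := eqVneq x y'.
    subst y' => _; rewrite (Fswap _ _ _ Kp').
    by apply: same_first => //; [exact: far_pairs_swap|rewrite -two_point_swap].
  by move=> /eqP; rewrite subr_eq0 eq_sym (negbTE t1).
move=> [[x y] t] p' Kp Kp' pp'.
(* At [t = 1] the first point is massless; swapping turns the parameter into 0. *)
have [t1|t1] := eqVneq t 1; last exact: first_neq1.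
rewrite (Fswap _ _ _ Kp); apply: first_neq1 => //.
- by rewrite t1 subrr eq_sym oner_neq0.
- exact: far_pairs_swap.
- by rewrite -two_point_swap.
Qed.

End two_points.

(** * The sphere *)

Section sphere_topology.
Context {R : realType} {n : nat}.
Local Notation V := 'rV[R]_n.+1.
Local Notation S := (sphere R n).
Implicit Types (u v w : V) (x y z : S).

Lemma dotNl m (u v : 'rV[R]_m) : dot (- u) v = - dot u v.
Proof. by rewrite /dot -sumrN; apply: eq_bigr => i _; rewrite mxE mulNr. Qed.

Lemma dotZZ m (a b : R) (u v : 'rV[R]_m) :
  dot (a *: u) (b *: v) = a * b * dot u v.
Proof.
by rewrite /dot mulr_sumr; apply: eq_bigr => i _; rewrite !mxE; ring.
Qed.

Lemma dot_gt0 v : (0 < dot v v) = (v != 0).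
Proof.
rewrite lt_neqAle dot_ge0 andbT eq_sym; congr (~~ _).
apply/eqP/eqP => [/dot_eq0//|->].
by rewrite /dot big1// => i _; rewrite mxE mulr0.
Qed.

Lemma cvg_dot {T : Type} {F : set_system T} {FF : Filter F} (f g : T -> V) u v :
  f @ F --> u -> g @ F --> v -> (fun t => dot (f t) (g t)) @ F --> dot u v.
Proof.
move=> fu gv; rewrite /dot; apply: cvg_big => [|i _].
  by move=> ?; exact: add_continuous.
apply: cvgM.
  exact: (cvg_comp _ _ fu (@coord_continuous _ _ _ 0 i u)).
exact: (cvg_comp _ _ gv (@coord_continuous _ _ _ 0 i v)).
Qed.

Lemma cos_mdist x y : cos (mdist x y) = dot x y.
Proof. by apply: acosK; rewrite in_itv/=; exact: sphere_dot_itv. Qed.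

Lemma mdist_le_pi x y : mdist x y <= pi.
Proof. by apply: acos_lepi; exact: sphere_dot_itv. Qed.

Lemma lt_mdist_cos r x y : 0 <= r <= pi -> (mdist x y < r) = (cos r < dot x y).
Proof.
move=> r0pi; rewrite -cos_mdist ltr_cos// in_itv/=.
by rewrite mdist_ge0 mdist_le_pi.
Qed.

Lemma ge_mdist_cos r x y : 0 <= r <= pi ->
  (r <= mdist x y) = (dot x y <= cos r).
Proof. by move=> r0pi; rewrite leNgt lt_mdist_cos// -leNgt. Qed.

(** The squared chord is $2 - 2\cos d(x,y)$ and bounds the square of each coordinate of $x - y$; the
    cosine is continuous at 0. *)
Lemma sphere_val_continuous : continuous (@sphere_val R n).
Proof.
move=> x; have xF : Filter (nbhs x) := nbhs_filter x; apply/cvg_ballP => e e0.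
have e20 : 0 < e ^+ 2 / 2 by rewrite divr_gt0 ?exprn_gt0.
have /cvgrPdist_lt/(_ _ e20)/nbhs_ballP[d /= d0 dcos] := @continuous_cos R 0.
apply/(@nbhs_ballP _ S); exists d => //= y; rewrite ballEmdist /= => xyd.
have := dcos (mdist x y); rewrite /ball /= sub0r normrN ger0_norm ?mdist_ge0//.
rewrite cos0 cos_mdist => /(_ xyd); rewrite ger0_norm; last first.
  by have /andP[_ ?] := sphere_dot_itv x y; rewrite subr_ge0.
move=> xye; split => // i j; rewrite ord1 /ball /=.
rewrite -ltr_sqr ?nnegrE ?normr_ge0 ?ltW// real_normK ?num_real//.
apply: (@le_lt_trans _ _ (dot (1 *: val x + (-1) *: val y)
                              (1 *: val x + (-1) *: val y))).
  rewrite /dot (bigD1 j)//= !mxE -expr2 mul1r mulN1r lerDl sumr_ge0// => k _.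
  by rewrite -expr2 sqr_ge0.
rewrite dot_comb_sqr !sphere_dotxx; move: xye; rewrite ltr_pdivlMr//; lra.
Qed.

(** Converse to [sphere_val_continuous]: the geodesic topology is the one induced from the ambient
    space, so convergence is checked on vectors. *)
Lemma cvg_sphere {T : Type} {F : set_system T} {FF : Filter F} (f : T -> S) x :
  (fun t => sphere_val (f t)) @ F --> sphere_val x -> f @ F --> x.
Proof.
move=> fx; apply/(@cvg_ballP _ S) => e e0.
(* The cap at [pi] keeps [d] where the cosine is strictly decreasing. *)
pose d := Num.min e pi.
have d0pi : 0 <= d <= pi.
  by rewrite le_min ge_min lexx orbT pi_ge0 ltW.
have d0 : 0 < d by rewrite lt_min e0 pi_gt0.
have dotf : (fun t => dot x (f t)) @ F --> (1 : R).
  by rewrite -(sphere_dotxx x); apply: cvg_dot => //; exact: cvg_cst.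
have /cvgrPdist_lt/(_ (1 - cos d)) := dotf.
rewrite subr_gt0 -cos0 ltr_cos ?in_itv/= ?lexx ?pi_ge0// => /(_ d0).
apply: filterS => t; rewrite cos0 ballEmdist /= => xd.
apply: (@lt_le_trans _ _ d); last by rewrite ge_min lexx.
rewrite lt_mdist_cos//; have := le_lt_trans (ler_norm _) xd; lra.
Qed.

(** At [v = 0] the default of [insubd], the base point, is returned. *)
Definition normalize v : S :=
  insubd (point : S) ((Num.sqrt (dot v v))^-1 *: v).

Lemma normalizeE v : v != 0 ->
  sphere_val (normalize v) = (Num.sqrt (dot v v))^-1 *: v.
Proof.
rewrite -dot_gt0 => v0; apply: insubdK; rewrite /in_mem /=.
rewrite dotZZ -expr2 exprVn sqr_sqrtr ?ltW//.
by rewrite mulVf// gt_eqF.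
Qed.

Lemma normalize_cvg {T : Type} {F : set_system T} {FF : Filter F}
    (f : T -> V) v :
  v != 0 -> f @ F --> v -> (fun t => normalize (f t)) @ F --> normalize v.
Proof.
move=> v0 fv; apply: cvg_sphere; rewrite normalizeE//.
have dotf : (fun t => dot (f t) (f t)) @ F --> (dot v v : R).
  exact: cvg_dot.
have : (fun t => (Num.sqrt (dot (f t) (f t)))^-1 *: f t) @ F -->
    (Num.sqrt (dot v v))^-1 *: v.
  apply: cvgZ => //; apply: cvgV.
    by rewrite gt_eqF// sqrtr_gt0 dot_gt0.
  apply: (@cvg_comp _ _ _ (fun t => dot (f t) (f t)) Num.sqrt).
    exact: dotf.
  exact: sqrt_continuous.
(* The explicit formula needs [f t] nonzero, which holds once [dot (f t) (f t)] is within [dot v v]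
   of its limit. *)
apply: cvg_trans; apply: near_eq_cvg.
have /cvgrPdist_lt/(_ (dot v v)) := dotf; rewrite dot_gt0 => /(_ v0).
apply: filterS => t ft; rewrite normalizeE// -dot_gt0.
by have := le_lt_trans (ler_norm _) ft; lra.
Qed.

Lemma normalize_val x : normalize x = x.
Proof.
apply: val_inj; rewrite /= normalizeE ?sphere_dotxx ?sqrtr1 ?invr1 ?scale1r//.
by rewrite -dot_gt0 sphere_dotxx.
Qed.

Lemma normalizeN v : v != 0 -> normalize (- v) = antipode (normalize v).
Proof.
by move=> v0; apply: val_inj; rewrite /= !normalizeE ?oppr_eq0// dotNN scalerN.
Qed.

(** The sphere is the image under [normalize] of the unit vectors, a closed subset of the box
    $[-1,1]^{n+1}$. *)
Lemma compact_sphere : compact [set: S].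
Proof.
pose U := [set v : V | dot v v = 1].
have U0 v : U v -> v != 0 by rewrite -dot_gt0 => ->.
have -> : [set: S] = normalize @` U.
  apply/seteqP; split => // x _; exists x; first exact: sphere_dotxx.
  exact: normalize_val.
apply: continuous_compact.
  apply/subspace_continuousP => v /U0 v0; apply: normalize_cvg => //.
  exact: cvg_within.
have box := rV_compact (fun i : 'I_n.+1 => @segment_compact R (-1) 1).
apply: subclosed_compact box _; last first.
  move=> v Uv j; rewrite /= in_itv /= -ler_norml.
  rewrite -ler_sqr ?nnegrE// real_normK ?num_real// expr1n -Uv.
  rewrite /dot (bigD1 j)//= -expr2 lerDl sumr_ge0// => k _.
  by rewrite -expr2 sqr_ge0.
have -> : U = (fun v => dot v v) @^-1` [set 1] by [].
apply: closed_comp => [v _|]; last exact: closed_eq.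
by apply: (@cvg_dot _ (nbhs v) _ id id v v) => A.
Qed.

Lemma compact_far_pairs r : compact (far_pairs r : set (S * S * R)).
Proof.
have -> : far_pairs r = ([set: S] `*` [set: S] `*` `[0, 1]) `&`
    [set p : S * S * R | r <= mdist p.1.1 p.1.2].
  apply/seteqP; split => p /=.
    by case=> rp p01; rewrite in_itv.
  by rewrite in_itv /= => -[[_ p01] rp]; split.
apply: compact_closedI.
  apply: compact_setX; last exact: segment_compact.
  by apply: compact_setX; exact: compact_sphere.
have -> : [set p : S * S * R | r <= mdist p.1.1 p.1.2] =
    (fun p : S * S * R => mdist p.1.1 p.1.2) @^-1` [set d | r <= d] by [].
apply: closed_comp => [p _|]; last exact: closed_ge.
apply: (@cvg_comp _ _ _ fst (fun z : S * S => mdist z.1 z.2)).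
  exact: cvg_fst.
exact: mdist_fst_snd_continuous.
Qed.

End sphere_topology.

(** * Sliding two points to antipodal ones *)

Section antipodal_slide.
Context {R : realType} {n : nat}.
Local Notation V := 'rV[R]_n.+1.
Local Notation S := (sphere R n).
Implicit Types (u v : V) (x y z : S) (a b r s t : R) (p : S * S * R).

(** Tripling the angle gives $4c^3 - 3c - 1 = (c-1)(2c+1)^2 = 0$ for the cosine $c$, and $c < 1$. *)
Lemma cos_two_thirds_pi : cos (2 * pi / 3 : R) = - 1 / 2.
Proof.
pose c : R := 2 * pi / 3.
have c01 : 0 < c by rewrite divr_gt0 ?mulr_gt0 ?pi_gt0.
have cpi : c <= pi.
  by rewrite /c ler_pdivrMr//; have := @pi_ge0 R; move: pi => q; lra.
have cos_lt1 : cos c < 1.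
  by rewrite -cos0 ltr_cos ?in_itv/= ?lexx ?pi_ge0 ?(ltW c01).
have : cos (c *+ 2 + c) = 1.
  have -> : c *+ 2 + c = pi *+ 2; last exact: cos2pi.
  by rewrite /c; move: (pi : R) => q; rewrite !mulr2n; field.
rewrite cosD cos_mulr2n sin_mulr2n => cos3; rewrite !mulr2n in cos3.
have := cos2Dsin2 c => cs.
have : (cos c - 1) * (2 * cos c + 1) ^+ 2 = 0 by nra.
move/eqP; rewrite mulf_eq0 sqrf_eq0 subr_eq0 lt_eqF//= -/c => /eqP; lra.
Qed.

Lemma cos_lt_half r : 2 * pi / 3 < r -> r <= pi -> cos r < - 1 / 2.
Proof.
move=> hr rpi; rewrite -cos_two_thirds_pi.
have r0 : 0 <= 2 * pi / 3 :> R by rewrite divr_ge0 ?mulr_ge0 ?pi_ge0.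
by rewrite ltr_cos// in_itv /=; have := @pi_ge0 R; lra.
Qed.

(** The chord from [x] to the antipode of [y]. At [a = t] it spans the line assigned to
    $(1-t)\delta_x + t\delta_y$. *)
Definition toward a x y : V := (1 - a) *: sphere_val x + (- a) *: sphere_val y.

Lemma toward0 x y : toward 0 x y = x.
Proof. by rewrite /toward subr0 scale1r oppr0 scale0r addr0. Qed.

Lemma toward1 x y : toward 1 x y = - sphere_val y.
Proof. by rewrite /toward subrr scale0r add0r scaleN1r. Qed.

Lemma towardC a x y : toward (1 - a) y x = - toward a x y.
Proof. by apply/rowP => i; rewrite !mxE; ring. Qed.

Lemma toward_antipode a x : toward a x (antipode x) = x.
Proof. by apply/rowP => i; rewrite !mxE; ring. Qed.

(** The squared norm is at least $(1-a)^2 + a^2 = ((2a-1)^2 + 1)/2$. *)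
Lemma toward_neq0 a x y : 0 <= a <= 1 -> dot x y <= 0 -> toward a x y != 0.
Proof.
move=> /andP[a0 a1] xy.
have : 0 <= a * (1 - a) * - dot x y by rewrite !mulr_ge0//; lra.
have := sqr_ge0 (2 * a - 1).
by rewrite -dot_gt0 /toward dot_comb_sqr !sphere_dotxx; lra.
Qed.

Lemma toward_le1 a x y : 0 <= a <= 1 -> dot (toward a x y) (toward a x y) <= 1.
Proof.
move=> /andP[a0 a1]; have /andP[xy _] := sphere_dot_itv x y.
have : 0 <= a * (1 - a) * (dot x y + 1) by rewrite !mulr_ge0//; lra.
by rewrite /toward dot_comb_sqr !sphere_dotxx; lra.
Qed.

(** The right side exceeds the left by $((1-a)b + a(1-b))(1 + \langle x,y\rangle)$. With
    [dot_normalize_le], sliding never brings the points closer. *)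
Lemma dot_toward a b x y : 0 <= a <= 1 -> 0 <= b <= 1 ->
  dot (toward a x y) (toward b y x) <= dot x y.
Proof.
move=> /andP[a0 a1] /andP[b0 b1]; have /andP[xy _] := sphere_dot_itv x y.
rewrite /toward dot_comb !(dotC _ (_ + _)) !dot_comb !sphere_dotxx (dotC y x).
have : 0 <= ((1 - a) * b + a * (1 - b)) * (dot x y + 1).
  by apply: mulr_ge0; [apply: addr_ge0; apply: mulr_ge0|]; lra.
lra.
Qed.

(** Stretching vectors of norm at most 1 to unit length can only lower a nonpositive inner
    product. *)
Lemma dot_normalize_le u v c : u != 0 -> v != 0 ->
  dot u u <= 1 -> dot v v <= 1 -> c <= 0 -> dot u v <= c ->
  dot (normalize u) (normalize v) <= c.
Proof.
move=> u0 v0 u1 v1 c0 uvc; rewrite !normalizeE// dotZZ.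
have inv1 (w : V) : w != 0 -> dot w w <= 1 -> 1 <= (Num.sqrt (dot w w))^-1.
  move=> w0 w1; have sw : 0 < Num.sqrt (dot w w) by rewrite sqrtr_gt0 dot_gt0.
  by rewrite invf_ge1// -[leRHS]sqrtr1 ler_wsqrtr.
have := mulr_ege1 (inv1 _ u0 u1) (inv1 _ v0 v1).
set k := _ * _ => k1; nra.
Qed.

(* For [s] from [1] down to [1/2] the two points slide along the geodesics
   towards the common line, with the weight fixed; from [1/2] down to [0] the
   weight moves to [1/2]. *)
Definition slide p s : S * S * R :=
  let a := Num.min (2 * (1 - s)) 1 in let b := Num.max (1 - 2 * s) 0 in
  (normalize (toward (a * p.2) p.1.1 p.1.2),
   normalize (toward (a * (1 - p.2)) p.1.2 p.1.1), (1 - b) * p.2 + b / 2).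

Section far.
Variable r : R.
Hypotheses (hr : 2 * pi / 3 < r) (hrpi : r <= pi).

Lemma far_gt0 : 0 < r.
Proof. by apply: lt_trans hr; rewrite divr_gt0 ?mulr_gt0 ?pi_gt0. Qed.

Lemma far_pairsP p :
  far_pairs r p <-> dot p.1.1 p.1.2 <= cos r /\ 0 <= p.2 <= 1.
Proof. by rewrite /far_pairs /= ge_mdist_cos// (ltW far_gt0). Qed.

Lemma far_dot_lt0 p : far_pairs r p -> dot p.1.1 p.1.2 < 0.
Proof. by move=> /far_pairsP[+ _]; have := cos_lt_half hr hrpi; lra. Qed.

Lemma slide_coef p s : far_pairs r p -> 0 <= s <= 1 ->
  0 <= Num.min (2 * (1 - s)) 1 * p.2 <= 1 /\
  0 <= Num.min (2 * (1 - s)) 1 * (1 - p.2) <= 1.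
Proof.
move=> [_ /andP[t0 t1]] /andP[s0 s1].
have : 0 <= Num.min (2 * (1 - s)) 1 by rewrite le_min; lra.
have : Num.min (2 * (1 - s)) 1 <= 1 by rewrite ge_min lexx orbT.
by move: (Num.min _ _) => a a1 a0; split; apply/andP; split; nra.
Qed.

Lemma slide_far p s : far_pairs r p -> 0 <= s <= 1 -> far_pairs r (slide p s).
Proof.
move=> Kp s01; have [a01 b01] := slide_coef Kp s01.
have /far_pairsP[xyr /andP[t0 t1]] := Kp; have xy0 := ltW (far_dot_lt0 Kp).
apply/far_pairsP; split => /=.
  apply: dot_normalize_le.
  - exact: toward_neq0.
  - by apply: toward_neq0 => //; rewrite dotC.
  - exact: toward_le1.
  - exact: toward_le1.
  - by have := cos_lt_half hr hrpi; lra.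
  - by apply: le_trans xyr; exact: dot_toward.
case/andP: s01 => s0 s1.
have : 0 <= Num.max (1 - 2 * s) 0 by rewrite le_max lexx orbT.
have : Num.max (1 - 2 * s) 0 <= 1 by rewrite ge_max; lra.
by move: (Num.max _ _) => b b1 b0; apply/andP; split; nra.
Qed.

(** At [s = 0] both [a] and [b] are 1, and [towardC] makes the second vector the negative of the
    first. *)
Lemma slide0 p : far_pairs r p ->
  slide p 0 = let z := normalize (toward p.2 p.1.1 p.1.2) in
              (z, antipode z, 1 / 2).
Proof.
move=> Kp; rewrite /slide subr0 mulr0 subr0 mulr1 min_r ?ler1n//.
rewrite max_l// !mul1r subrr mul0r add0r towardC normalizeN//.
by apply: toward_neq0; [exact: Kp.2|exact: ltW (far_dot_lt0 Kp)].
Qed.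

Lemma slide1 p : slide p 1 = p.
Proof.
case: p => -[x y] t; rewrite /slide subrr mulr0 min_l// mulr1.
rewrite max_r; last by rewrite subr_le0 ler1n.
by rewrite !mul0r !toward0 !normalize_val subr0 mul1r addr0.
Qed.

Lemma slide_swap x y t s :
  slide (y, x, 1 - t) s = ((slide (x, y, t) s).1.2, (slide (x, y, t) s).1.1,
                           1 - (slide (x, y, t) s).2).
Proof. by rewrite /slide /= subKr; congr (_, _, _); field. Qed.

Lemma two_point_slide p p' s : far_pairs r p -> far_pairs r p' ->
  0 <= s <= 1 -> two_point r p = two_point r p' ->
  two_point r (slide p s) = two_point r (slide p' s).
Proof.
move=> Kp Kp' s01.
apply: (two_point_descend (F := fun p => two_point r (slide p s))) far_gt0
  _ _ _ _ _ _ => //.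
  move=> x y t /slide_far/(_ s01); rewrite slide_swap.
  by case: (slide _ _) => -[x' y'] t' /=; exact: two_point_swap far_gt0.
move=> x y y' /slide_far/(_ s01) Kq /slide_far/(_ s01); move: Kq.
rewrite /slide /= !mulr0 !toward0 add0r subr0 mulr1.
(* The measure is $\delta_x$ and [y] is arbitrary. For [s >= 1/2] the second weight is still 0; for
   smaller [s] the second point has already reached the antipode of [x], whatever [y] was. *)
have [s2|s2] := leP (1 / 2) s.
  rewrite max_r ?mul0r; last by lra.
  exact: two_point_pole far_gt0.
by rewrite min_r ?toward1//; lra.
Qed.

Lemma no_far_triple x y z : r <= mdist x y -> r <= mdist y z ->
  r <= mdist x z -> False.
Proof.
rewrite !ge_mdist_cos ?(ltW far_gt0)// => xy yz xz.
have := cos_lt_half hr hrpi.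
have := dot_ge0 (1 *: (1 *: val x + 1 *: val y) + 1 *: val z).
rewrite dot_comb_sqr dot_comb_sqr dot_comb !sphere_dotxx; lra.
Qed.

Lemma two_point_surj (mu : AVR S r) :
  exists2 p, far_pairs r p & two_point r p = mu.
Proof.
have far x y : x \in finsupp mu -> y \in finsupp mu -> x != y -> r <= mdist x y.
  move=> xs ys xy; rewrite -lee_fin; apply: le_trans (avr_spread mu) _.
  by apply: ereal_inf_lbound; exists (x, y) => //; split => //; exact/eqP.
have [x xs] : exists x, x \in finsupp mu.
  have [mu0|[x xs]] := fset_0Vmem (finsupp mu); last by exists x.
  have := avr_sum1 mu; rewrite mu0 big_seq_fset0 => /esym/eqP.
  by rewrite oner_eq0.
have [y [xy sub]] : exists y, r <= mdist x y /\
    (finsupp mu `<=` [fset x; y])%fset.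
  have [[y [ys xy]]|none] := pselect (exists y, y \in finsupp mu /\ x != y).
    exists y; split; first exact: far.
    apply/fsubsetP => z zs; rewrite !inE; apply: contrapT => /negP.
    rewrite negb_or => /andP[zx zy]; apply: (@no_far_triple x y z);
      apply: far => //.
      by rewrite eq_sym.
    by rewrite eq_sym.
  (* For a Dirac measure the antipode, at distance [pi], serves as the massless second point. *)
  exists (antipode x); split.
    rewrite ge_mdist_cos ?(ltW far_gt0)//.
    have := sphere_dotxx x; rewrite dotC /= dotNl => ->.
    by have /andP[] : -1 <= cos r <= 1 by rewrite cos_geN1 cos_le1.
  apply/fsubsetP => z zs; rewrite !inE; apply/orP; left.
  by apply: contrapT => /negP zx; apply: none; exists z; rewrite eq_sym.
have xNy : x != y by rewrite -mdist_gt0 (lt_le_trans far_gt0).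
have := avr_sum1 mu.
rewrite (@big_fset_incl _ _ _ _ _ _ _ sub); last first.
  by move=> z _ zN; rewrite fsfun_dflt.
rewrite big_fsetU1 ?inE//= big_seq_fset1 => mu1.
have Kp : far_pairs r (x, y, avr_weight mu y).
  by split => //=; have := avr_ge0 mu x; have := avr_ge0 mu y; lra.
exists (x, y, avr_weight mu y) => //; apply: AVR_eqP => z.
rewrite (two_pointE far_gt0 Kp) pair_weightE /=.
have [->|zx] := eqVneq z x; first by lra.
have [->//|zy] := eqVneq z y.
rewrite fsfun_dflt//; apply/negP => /(fsubsetP sub).
by rewrite !inE (negbTE zx) (negbTE zy).
Qed.

End far.

End antipodal_slide.

(** * The homotopy equivalence *)

Section equivalence.
Context {R : realType} {n : nat} {r : R}.
Local Notation S := (sphere R n).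
Hypotheses (hr : 2 * pi / 3 < r) (hrpi : r <= pi).

Let r0 : 0 < r := far_gt0 hr.

(** A mere choice of parameters, with no continuity claimed; functions of it are compared with
    functions on [far_pairs r] through [two_point]. *)
Definition coords (mu : AVR S r) : S * S * R :=
  s2val (cid2 (two_point_surj hr hrpi mu)).

Lemma coords_far mu : far_pairs r (coords mu).
Proof. exact: (s2valP (cid2 (two_point_surj hr hrpi mu))). Qed.

Lemma coordsK mu : two_point r (coords mu) = mu.
Proof. exact: (s2valP' (cid2 (two_point_surj hr hrpi mu))). Qed.

(** * The map to projective space *)

Definition line_at (p : S * S * R) : RP R n :=
  \pi_(RP R n)%qT (normalize (toward p.2 p.1.1 p.1.2)).

Lemma pi_antipode (x : S) :
  \pi_(RP R n)%qT (antipode x) = \pi_(RP R n)%qT x.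
Proof. by apply/eqquotP; rewrite /= /antipodal antipodeK eqxx orbT. Qed.

Lemma line_at_two_point p p' : far_pairs r p -> far_pairs r p' ->
  two_point r p = two_point r p' -> line_at p = line_at p'.
Proof.
apply: (two_point_descend (F := line_at) r0) => [x y t Kp|x y y' _ _].
  rewrite /line_at /= towardC normalizeN ?pi_antipode//.
  by apply: toward_neq0; [exact: Kp.2|exact: ltW (far_dot_lt0 hr hrpi Kp)].
by rewrite /line_at /= !toward0.
Qed.

Definition line_of (mu : AVR S r) : RP R n := line_at (coords mu).

Lemma line_ofE p : far_pairs r p -> line_of (two_point r p) = line_at p.
Proof.
move=> Kp; apply: line_at_two_point => //; first exact: coords_far.
by rewrite coordsK.
Qed.

Lemma image_far_pairs : two_point r @` far_pairs r = [set: AVR S r].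
Proof.
apply/seteqP; split => // mu _; exists (coords mu); first exact: coords_far.
exact: coordsK.
Qed.

Lemma cvg_toward {T : Type} {F : set_system T} {FF : Filter F}
    (a : T -> R) (f g : T -> S) (l : R) (x y : S) :
  a @ F --> l -> f @ F --> x -> g @ F --> y ->
  (fun i => toward (a i) (f i) (g i)) @ F --> toward l x y.
Proof.
move=> al fx gy.
have fx' := cvg_comp _ _ fx (@sphere_val_continuous _ _ x).
have gy' := cvg_comp _ _ gy (@sphere_val_continuous _ _ y).
apply: cvgD; apply: cvgZ => //; first by apply: cvgB => //; exact: cvg_cst.
exact: cvgN.
Qed.

Lemma line_of_continuous : continuous line_of.
Proof.
apply/continuous_subspace_setT; rewrite -image_far_pairs.
apply: within_image_continuous.
- exact: AVR_hausdorff.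
- exact: compact_far_pairs.
- exact: two_point_continuous.
apply: (@subspace_eq_continuous _ _ _ line_at).
  by move=> p /set_mem Kp; exact/esym/line_ofE.
apply/subspace_continuousP => p Kp.
apply: (@cvg_comp _ _ _ (fun p => normalize (toward p.2 p.1.1 p.1.2))
  (\pi_(RP R n)%qT)); last exact: pi_continuous.
apply: normalize_cvg.
  by apply: toward_neq0; [exact: Kp.2|exact: ltW (far_dot_lt0 hr hrpi Kp)].
apply: cvg_within_filter; apply: cvg_toward.
- exact: cvg_snd.
- by apply: cvg_comp; [exact: cvg_fst|exact: cvg_fst].
- by apply: cvg_comp; [exact: cvg_fst|exact: cvg_snd].
Qed.

(** * The map back from projective space *)

Lemma antipodal_far (x : S) : far_pairs r (x, antipode x, 1 / 2).
Proof.
apply/far_pairsP => //=; split; last by lra.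
have := sphere_dotxx x; rewrite dotC dotNl => ->.
exact: cos_geN1.
Qed.

Definition halves (x : S) : AVR S r := two_point r (x, antipode x, 1 / 2).

Lemma halves_antipode x : halves (antipode x) = halves x.
Proof.
rewrite /halves (two_point_swap r0); last exact: antipodal_far.
by rewrite antipodeK; congr (two_point r (_, _, _)); field.
Qed.

Lemma antipode_continuous : continuous (@antipode R n).
Proof.
move=> x; have xF : Filter (nbhs x) := nbhs_filter x; apply: cvg_sphere => /=.
exact: cvgN (@sphere_val_continuous _ _ x).
Qed.

Lemma halves_continuous : continuous halves.
Proof.
apply/continuous_subspace_setT.
apply: (@within_comp_continuous _ _ _ _ (far_pairs r)
  (fun x : S => (x, antipode x, 1 / 2))); last exact: two_point_continuous.
  by move=> x _; exact: antipodal_far.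
move=> x _; have xF : Filter (nbhs x) := nbhs_filter x.
apply: cvg_pair_nbhs; last exact: cvg_cst.
by apply: cvg_pair_nbhs; [by move=> A|exact: antipode_continuous].
Qed.

Lemma halves_pi (x y : S) :
  \pi_(RP R n)%qT x = \pi_(RP R n)%qT y -> halves x = halves y.
Proof. by move=> /eqquotP /orP[]/eqP ->; rewrite ?halves_antipode. Qed.

Definition halves_of (z : RP R n) : AVR S r := halves (repr z).

Lemma halves_of_pi (x : S) : halves_of (\pi_(RP R n)%qT x) = halves x.
Proof. by apply: halves_pi; rewrite reprK. Qed.

Lemma halves_of_continuous : continuous halves_of.
Proof.
apply/quotient_continuous; rewrite (_ : _ \o _ = halves).
  exact: halves_continuous.
by apply/funext => x; exact: halves_of_pi.
Qed.

Lemma line_of_halves z : line_of (halves_of z) = z.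
Proof.
rewrite line_ofE; last exact: antipodal_far.
by rewrite /line_at /= toward_antipode normalize_val reprK.
Qed.

(** * The homotopy on measures *)

Lemma slide_continuous (q : S * S * R * R) :
  far_pairs r q.1 -> 0 <= q.2 <= 1 ->
  {for q, continuous (fun q : S * S * R * R => slide q.1 q.2)}.
Proof.
move=> Kq s01; have [a01 b01] := slide_coef Kq s01.
have xy0 := ltW (far_dot_lt0 hr hrpi Kq).
have cp : (fun q : S * S * R * R => q.1) @ q --> q.1 by exact: cvg_fst.
have cxy : (fun q : S * S * R * R => q.1.1) @ q --> q.1.1.
  exact: (cvg_comp _ _ cp cvg_fst).
have cx : (fun q : S * S * R * R => q.1.1.1) @ q --> q.1.1.1.
  exact: (cvg_comp _ _ cxy cvg_fst).
have cy : (fun q : S * S * R * R => q.1.1.2) @ q --> q.1.1.2.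
  exact: (cvg_comp _ _ cxy cvg_snd).
have ct : (fun q : S * S * R * R => q.1.2) @ q --> q.1.2.
  exact: (cvg_comp _ _ cp cvg_snd).
have cs : (fun q : S * S * R * R => q.2) @ q --> q.2 by exact: cvg_snd.
have ca : (fun q : S * S * R * R => Num.min (2 * (1 - q.2)) 1) @ q -->
    Num.min (2 * (1 - q.2)) 1.
  apply: (@continuous_min R (S * S * R * R)%type
    (fun q => 2 * (1 - q.2)) (fun=> 1)); last exact: cvg_cst.
  by apply: cvgMr; apply: cvgB => //; exact: cvg_cst.
have cb : (fun q : S * S * R * R => Num.max (1 - 2 * q.2) 0) @ q -->
    Num.max (1 - 2 * q.2) 0.
  apply: (@continuous_max R (S * S * R * R)%type
    (fun q => 1 - 2 * q.2) (fun=> 0)); last exact: cvg_cst.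
  by apply: cvgB; [exact: cvg_cst|exact: cvgMr].
have c1 : (fun=> 1 : R) @ q --> (1 : R) by exact: cvg_cst.
rewrite /slide; apply: cvg_pair_nbhs; first apply: cvg_pair_nbhs.
(* The vector need only be nonzero at [q] itself, so continuity holds in the whole product and not
   merely within [far_pairs r]. *)
- apply: normalize_cvg; first exact: toward_neq0.
  by apply: cvg_toward => //; exact: cvgM.
- apply: normalize_cvg; first by apply: toward_neq0 => //; rewrite dotC.
  by apply: cvg_toward => //; apply: cvgM => //; exact: cvgB.
- by apply: cvgD; [apply: cvgM => //; exact: cvgB|exact: cvgMl].
Qed.

Lemma halves_line_homotopic : homotopic R (halves_of \o line_of) idfun.
Proof.
pose H (q : AVR S r * R) := two_point r (slide (coords q.1) q.2).
exists H; split => [|mu|mu]; last 2 first.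
- rewrite /H /= (slide0 hr hrpi)//; last exact: coords_far.
  by rewrite /line_of /line_at halves_of_pi.
- by rewrite /H /= slide1 coordsK.
pose K := far_pairs r `*` `[0, 1] : set (S * S * R * R).
pose q (k : S * S * R * R) := (two_point r k.1, k.2).
have -> : [set: AVR S r] `*` `[0, 1] = q @` K.
  apply/seteqP; split => [[mu s] /= [_ s01]|_ [[p s] /= [Kp s01] <-]//].
  exists (coords mu, s); last by rewrite /q /= coordsK.
  by split => //; exact: coords_far.
apply: within_image_continuous.
- by apply: hausdorff_setX; [exact: AVR_hausdorff|exact: norm_hausdorff].
- by apply: compact_setX; [exact: compact_far_pairs|exact: segment_compact].
- apply/subspace_continuousP => -[p s] [/= Kp s01]; apply: cvg_pair_nbhs.
    have /subspace_continuousP : {within K, continuous (two_point r \o fst)}.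
      apply: (within_comp_continuous (B := far_pairs r)) => [k []//|k _|].
        exact: cvg_fst.
      exact: two_point_continuous.
    by apply.
  by apply: cvg_within_filter; exact: cvg_snd.
(* By [two_point_slide] the chosen coordinates may be replaced on [K] by the given parameters, which
   vary continuously. *)
apply: (@subspace_eq_continuous _ _ _
    (two_point r \o (fun k : S * S * R * R => slide k.1 k.2))).
  move=> [p s] /set_mem [/= Kp]; rewrite in_itv /= => s01.
  apply: two_point_slide => //; first exact: coords_far.
  by rewrite coordsK.
apply: (within_comp_continuous (B := far_pairs r)).
- by move=> [p s] [/= Kp]; rewrite in_itv /=; exact: slide_far.
- by move=> [p s] [/= Kp s01]; exact: (@slide_continuous (p, s)).
- exact: two_point_continuous.
Qed.

End equivalence.

Theorem theorem5p1 (R : realType) (n : nat) (hn : (1 <= n)%N) (r : R)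
    (hr : 2 * pi / 3 < r) (hrpi : r <= pi) :
  homotopy_equivalent R (AVR (sphere R n) r) (RP R n).
Proof.
exists (line_of hr hrpi), (@halves_of R n r); split.
- exact: line_of_continuous.
- exact: halves_of_continuous.
- exact: halves_line_homotopic.
(* This composite equals the identity, so a stationary homotopy suffices. *)
- exists fst; split => [|z|z] /=; last 2 first.
  + by rewrite line_of_halves.
  + by [].
  by apply: continuous_subspaceT => q; exact: cvg_fst.
Qed.
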